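(* Let $\mathcal F$ be a group pair, with $U$, $E$, $\mathcal I$, $S_{\mathcal X}$ and $A$ as in the context. Then $A$ is the universe of a complete and atomic Boolean algebra of subsets of $E$. The distinct elements of $A$ are the relations $S_{\mathcal X}$ for distinct subsets $\mathcal X\subseteq\mathcal I$. The atoms are the relations $R_{xy,\alpha}$ for $((x,y),\alpha)\in\mathcal I$. The unit is $E=S_{\mathcal I}$. The Boolean operations are computed on indices: for any system $(\mathcal X_\xi:\xi<\lambda)$ of subsets of $\mathcal I$ and any $\mathcal X\subseteq\mathcal I$, $$\bigcup_\xi S_{\mathcal X_\xi}=S_{\bigcup_\xi\mathcal X_\xi},\qquad \bigcap_\xi S_{\mathcal X_\xi}=S_{\bigcap_\xi\mathcal X_\xi},\qquad S_{\mathcal I}\setminus S_{\mathcal X}=S_{\mathcal I\setminus\mathcal X}.$$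
   Context: A group pair $\mathcal F=(\langle G_x:x\in I\rangle,\langle\varphi_{xy}:(x,y)\in\mathcal E\rangle)$ consists of the following data. - A set $I$ and a system of pairwise disjoint groups $G_x$ ($x\in I$), with operation $\circ$ and identity $e_x$. - An equivalence relation $\mathcal E$ on $I$. - For each $(x,y)\in\mathcal E$, a group isomorphism $\varphi_{xy}$ from $G_x/H_{xy}$ onto $G_y/K_{xy}$, where $H_{xy}$ is normal in $G_x$ and $K_{xy}$ is normal in $G_y$. For sets of group elements, $X\circ Y=\{a\circ b:a\in X,b\in Y\}$. For each $(x,y)\in\mathcal E$ fix an enumeration without repetitions $\langle H_{xy,\gamma}:\gamma<\kappa_{xy}\rangle$ ($\kappa_{xy}$ an ordinal) of the cosets of $H_{xy}$ in $G_x$, with $H_{xy,0}=H_{xy}$. Put $K_{xy,\gamma}=\varphi_{xy}(H_{xy,\gamma})$. Define: - $R_{xy,\alpha}=\bigcup_{\gamma<\kappa_{xy}}H_{xy,\gamma}\times(K_{xy,\gamma}\circ K_{xy,\alpha})$ for $\alpha<\kappa_{xy}$; - $U=\bigcup_{x\in I}G_x$ and $E=\bigcup\{G_x\times G_y:(x,y)\in\mathcal E\}$; - $\mathcal I=\{((x,y),\alpha):(x,y)\in\mathcal E,\ \alpha<\kappa_{xy}\}$; - $S_{\mathcal X}=\bigcup\{R_{xy,\alpha}:((x,y),\alpha)\in\mathcal X\}$ for $\mathcal X\subseteq\mathcal I$; - $A=\{S_{\mathcal X}:\mathcal X\subseteq\mathcal I\}$. *)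

(* Defs.v *)
From mathcomp Require Import all_boot.
From mathcomp Require Import monoid.
From mathcomp Require Import boolp classical_sets functions wochoice.

Set Implicit Arguments.
Unset Strict Implicit.
Unset Printing Implicit Defensive.

Local Open Scope group_scope.
Local Open Scope classical_set_scope.

(** * Possibly infinite groups: complex product, normal subgroups, quotients *)

Section Groups.
Variable G : groupType.

Definition cprod (X Y : set G) : set G := [set a * b | a in X & b in Y].

Definition normal_subgroup (H : set G) : Prop :=
  group_closed [in H] /\ forall h g, H h -> H (h ^ g).

(* For a normal subgroup H this is the underlying set of G / H, whose
   multiplication is [cprod]. *)
Definition cosets (H : set G) : set (set G) :=
  [set cprod [set g] H | g in [set: G]].

End Groups.

(* phi is only meaningful on the cosets of H. *)
Definition quotient_iso (G G' : groupType) (H : set G) (K : set G')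
    (phi : set G -> set G') : Prop :=
  set_bij (cosets H) (cosets K) phi /\
  forall X Y, cosets H X -> cosets H Y -> phi (cprod X Y) = cprod (phi X) (phi Y).

(** * Group pairs *)

(* The fields H, K and phi are total in the indices x and y for convenience;
   nothing is assumed about them (and nothing below depends on them) outside
   the equivalence relation. *)
Unset Implicit Arguments.

Record group_pair := GroupPair {
  gp_index : Type;
  gp_group : gp_index -> groupType;
  gp_equiv : gp_index -> gp_index -> Prop;
  gp_equivP : RelationClasses.Equivalence gp_equiv;
  gp_H : forall x y : gp_index, set (gp_group x);
  gp_K : forall x y : gp_index, set (gp_group y);
  gp_phi : forall x y : gp_index, set (gp_group x) -> set (gp_group y);
  gp_H_normal : forall x y, gp_equiv x y -> normal_subgroup (gp_H x y);
  gp_K_normal : forall x y, gp_equiv x y -> normal_subgroup (gp_K x y);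
  gp_phi_iso : forall x y, gp_equiv x y ->
    quotient_iso (gp_H x y) (gp_K x y) (gp_phi x y)
}.

Arguments gp_group {_} _.
Arguments gp_equiv {_} _ _.
Arguments gp_H {_} _ _.
Arguments gp_K {_} _ _.
Arguments gp_phi {_} _ _ _.

Set Implicit Arguments.

(* An ordinal kappa is represented by a well-ordered type, standing for
   {gamma : gamma < kappa}; the ordinal 0 is then its least element. *)
Record wo_type := WoType {
  wo_sort :> Type;
  wo_le : rel wo_sort;
  wo_leP : well_order wo_le
}.

Definition wo_least (k : wo_type) (z : k) : Prop := forall c : k, wo_le z c.

(* Bijectivity onto the set of cosets makes kappa_xy nonempty when (x, y) is in
   the equivalence relation, so that a least element does exist there. *)
Record coset_enum (F : group_pair) := CosetEnum {
  ce_kappa : gp_index F -> gp_index F -> wo_type;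
  ce_coset : forall x y : gp_index F, ce_kappa x y -> set (gp_group x);
  ce_cosetP : forall x y, gp_equiv x y ->
    set_bij [set: ce_kappa x y] (cosets (gp_H x y)) (@ce_coset x y);
  ce_coset0 : forall x y (z : ce_kappa x y), gp_equiv x y ->
    wo_least z -> ce_coset z = gp_H x y
}.

Section Relations.
Variables (F : group_pair) (C : coset_enum F).

(* The tagged union makes the groups pairwise disjoint. *)
Definition U : Type := {x : gp_index F & gp_group x}.

(* The image in U of a subset of G_x. *)
Definition inU (x : gp_index F) (X : set (gp_group x)) : set U :=
  existT (fun z => gp_group z : Type) x @` X.

Definition unit_rel : set (U * U) :=
  \bigcup_(xy in [set xy : gp_index F * gp_index F | gp_equiv xy.1 xy.2])
    (inU [set: gp_group xy.1] `*` inU [set: gp_group xy.2]).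

Definition cosetK x y (c : ce_kappa C x y) : set (gp_group y) :=
  gp_phi x y (ce_coset c).

Definition relR x y (a : ce_kappa C x y) : set (U * U) :=
  \bigcup_(c in [set: ce_kappa C x y])
    (inU (ce_coset c) `*` inU (cprod (cosetK c) (cosetK a))).

Definition index_type : Type :=
  {xy : gp_index F * gp_index F & ce_kappa C xy.1 xy.2}.

Definition index_set : set index_type :=
  [set i | gp_equiv (projT1 i).1 (projT1 i).2].

Definition relS (X : set index_type) : set (U * U) :=
  \bigcup_(i in X) relR (projT2 i).

Definition algA : set (set (U * U)) :=
  relS @` [set X | X `<=` index_set].

End Relations.

Arguments unit_rel F _ : clear implicits.
Arguments index_set {F} C _ : assert.
Arguments relS {F} C X _ : assert.

(** * Boolean algebras of sets *)

Section SetAlgebras.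
Variables (T : Type) (E : set T) (A : set (set T)).

Definition boolean_set_algebra : Prop :=
  [/\ forall X, A X -> X `<=` E,
      A set0 /\ A E,
      forall X Y, A X -> A Y -> A (X `|` Y),
      forall X Y, A X -> A Y -> A (X `&` Y) &
      forall X, A X -> A (E `\` X)].

(* Suprema and infima are taken in the poset (A, inclusion); they are not
   required to be unions and intersections. *)
Definition is_sup (B : set (set T)) (s : set T) : Prop :=
  [/\ A s, forall X, B X -> X `<=` s &
      forall t, A t -> (forall X, B X -> X `<=` t) -> s `<=` t].

Definition is_inf (B : set (set T)) (s : set T) : Prop :=
  [/\ A s, forall X, B X -> s `<=` X &
      forall t, A t -> (forall X, B X -> t `<=` X) -> t `<=` s].

Definition complete_algebra : Prop :=
  forall B, B `<=` A -> (exists s, is_sup B s) /\ (exists s, is_inf B s).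

Definition is_atom (a : set T) : Prop :=
  [/\ A a, a <> set0 & forall X, A X -> X `<=` a -> X = set0 \/ X = a].

Definition atomic_algebra : Prop :=
  forall X, A X -> X <> set0 -> exists2 a, is_atom a & a `<=` X.

End SetAlgebras.

(* Main.v *)
(* The relations R_{xy,alpha} partition E: given g in G_x, let H_{xy,c} be the
   coset containing g and pick k in K_{xy,c}; then (g, h) lies in R_{xy,alpha}
   iff k^-1 h lies in K_{xy,alpha}, and the cosets K_{xy,alpha} partition G_y.
   Everything else is the fact that the unions of the blocks of a partition form
   a complete atomic set algebra isomorphic to the power set of its indices. *)

Require Import Defs.
From mathcomp Require Import all_boot.
From mathcomp Require Import monoid.
From mathcomp Require Import boolp classical_sets functions.

Set Implicit Arguments.
Unset Strict Implicit.
Unset Printing Implicit Defensive.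

Local Open Scope classical_set_scope.

(** * Cosets of a normal subgroup *)

Section Cosets.
Local Open Scope group_scope.
Variables (G : groupType) (H : set G).
Hypothesis nH : normal_subgroup H.

Lemma normal_subgroup1 : H 1.
Proof. by have [[/set_mem]] := nH. Qed.

Lemma normal_subgroup_div a b : H a -> H b -> H (a / b).
Proof. by have [[_ Hdiv] _] := nH => Ha Hb; apply/set_mem/Hdiv; exact/mem_set. Qed.

Lemma normal_subgroupV a : H a -> H a^-1.
Proof. by move=> /(normal_subgroup_div normal_subgroup1); rewrite mul1g. Qed.

Lemma normal_subgroupM a b : H a -> H b -> H (a * b).
Proof.
by move=> Ha /normal_subgroupV/(normal_subgroup_div Ha); rewrite invgK.
Qed.

Lemma mem_coset g h : cprod [set g] H h <-> H (g^-1 * h).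
Proof.
split=> [[_ -> [u Hu <-]]|Hu]; first by rewrite mulKg.
by exists g => //; exists (g^-1 * h) => //; rewrite mulVKg.
Qed.

Lemma coset_uniq X Y g : cosets H X -> cosets H Y -> X g -> Y g -> X = Y.
Proof.
suff sub X' Y' : cosets H X' -> cosets H Y' -> X' g -> Y' g -> X' `<=` Y'.
  by move=> cX cY Xg Yg; apply/seteqP; split; apply: sub.
move=> [a _ <-] [b _ <-] /mem_coset ag /mem_coset bg h /mem_coset ah.
apply/mem_coset.
(* The factorisation is $b^{-1}h=(b^{-1}g)(a^{-1}g)^{-1}(a^{-1}h)$. *)
have := normal_subgroupM bg (normal_subgroupM (normal_subgroupV ag) ah).
by rewrite invgM invgK -!mulgA !mulVKg.
Qed.

(** Existence comes from surjectivity at the coset of [g], uniqueness from injectivity and the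
    disjointness of cosets. It serves for the cosets of both $H_{xy}$ and $K_{xy}$. *)
Lemma coset_index_uniq (J : Type) (f : J -> set G) (g : G) :
  set_bij [set: J] (cosets H) f -> exists! i, f i g.
Proof.
move=> [ffun finj fsurj].
have [|i _ fi] := fsurj (cprod [set g] H); first by exists g.
exists i; split=> [|j fjg].
  by rewrite fi mem_coset mulVg; exact: normal_subgroup1.
apply: finj; rewrite ?in_setT// fi.
apply: (@coset_uniq _ _ g) => //; [by exists g|exact: ffun|].
by rewrite mem_coset mulVg; exact: normal_subgroup1.
Qed.

Lemma mem_cprod_coset X Y g h : cosets H X -> cosets H Y -> X g ->
  cprod X Y h <-> Y (g^-1 * h).
Proof.
move=> cX [b _ <-] Xg; split=> [[a Xa [c Yc <-]]|Yh]; last first.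
  by exists g => //; exists (g^-1 * h) => //; rewrite mulVKg.
have ga : H (g^-1 * a).
  rewrite -mem_coset; suff <- : X = cprod [set g] H by [].
  apply: (@coset_uniq _ _ g) => //; first by exists g.
  by rewrite mem_coset mulVg; exact: normal_subgroup1.
move: Yc; rewrite !mem_coset => bc.
(* Normality enters here: $b^{-1}g^{-1}ac$ is the conjugate of $g^{-1}a$ by $b$, times $b^{-1}c$. *)
have := normal_subgroupM (proj2 nH _ b ga) bc.
by rewrite conjgE -!mulgA mulVKg.
Qed.

Lemma coset_nonempty X : cosets H X -> X !=set0.
Proof.
move=> [g _ <-]; exists (g * 1), g => //; exists 1 => //.
exact: normal_subgroup1.
Qed.

End Cosets.

(** * The set algebra generated by a partition *)

Section PartitionAlgebra.
Variables (J T : Type) (I : set J) (R : J -> set T).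
Hypotheses (R_disj : trivIset I R) (R_neq0 : forall i, I i -> R i !=set0).

Let E : set T := \bigcup_(i in I) R i.
Let S (X : set J) : set T := \bigcup_(i in X) R i.
Let A : set (set T) := S @` [set X | X `<=` I].

(** By disjointness, [p] lies in no other block, so a single point of a block decides whether its
    index is in [X]. This turns set operations on unions of blocks into operations on indices. *)
Lemma mem_block_bigcup i p X : X `<=` I -> I i -> R i p -> S X p <-> X i.
Proof.
move=> XI Ii Rip; split=> [[j Xj Rjp]|Xi]; last by exists i.
suff -> : i = j by [].
by apply: R_disj => //; [exact: XI|exists p].
Qed.

Lemma block_bigcup_le X Y : X `<=` I -> Y `<=` I -> S X `<=` S Y -> X `<=` Y.
Proof.
move=> XI YI SXY i Xi; have [p Rip] := R_neq0 (XI _ Xi).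
by apply/(mem_block_bigcup YI (XI _ Xi) Rip)/SXY; exists i.
Qed.

Lemma block_bigcup_inj : set_inj [set X | X `<=` I] S.
Proof.
move=> X Y /set_mem XI /set_mem YI SXY.
by apply/seteqP; split; apply: block_bigcup_le => //; rewrite SXY.
Qed.

Lemma block_bigcup_bij : set_bij [set X | X `<=` I] A S.
Proof.
by split=> [X XI||X //]; [exists X|exact: block_bigcup_inj].
Qed.

(** The factor [E] supplies the block containing a given point, which the intersection alone does
    not when [D] is empty. *)
Lemma block_bigcup_bigcap (L : Type) (D : set L) (X : L -> set J) :
  (forall k, D k -> X k `<=` I) ->
  E `&` \bigcap_(k in D) S (X k) = S (I `&` \bigcap_(k in D) X k).
Proof.
move=> XI; apply/seteqP; split=> [p [[i Ii Rip] Sp]|p [i [Ii Xi] Rip]].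
  exists i => //; split=> // k Dk.
  by apply/(mem_block_bigcup (XI _ Dk) Ii Rip)/Sp.
by split=> [|k Dk]; exists i => //; exact: Xi.
Qed.

Lemma block_bigcupD X : X `<=` I -> E `\` S X = S (I `\` X).
Proof.
move=> XI; apply/seteqP; split=> [p [[i Ii Rip] SXp]|p [i [Ii Xi] Rip]].
  by exists i => //; split=> //; rewrite -(mem_block_bigcup XI Ii Rip).
by split; [exists i|rewrite (mem_block_bigcup XI Ii Rip)].
Qed.

Lemma algebra_bigcup B : B `<=` A -> A (\bigcup_(b in B) b).
Proof.
(* Taking every index set whose union of blocks is in [B] avoids choosing one for each member of
   [B]. *)
move=> BA; exists (\bigcup_(X in [set X | X `<=` I /\ B (S X)]) X).
  by move=> i [X [XI _] Xi]; exact: XI.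
rewrite [LHS]bigcup_bigcup; apply/seteqP; split=> p.
  by move=> [X [_ BX] SXp]; exists (S X).
move=> [b Bb]; have [X XI Sb] := BA _ Bb; rewrite -Sb => SXp.
by exists X; rewrite /= ?Sb.
Qed.

Lemma algebra_bigcap B : B `<=` A -> A (E `&` \bigcap_(b in B) b).
Proof.
move=> BA; exists (I `&` \bigcap_(X in [set X | X `<=` I /\ B (S X)]) X).
  by move=> i [].
rewrite -block_bigcup_bigcap; last by move=> X [].
congr (_ `&` _); apply/seteqP; split=> p Sp.
  move=> b Bb; have [X XI Sb] := BA _ Bb.
  by rewrite -Sb; apply: Sp; rewrite /= Sb.
by move=> X [_ BX]; exact: Sp.
Qed.

Lemma algebra_sub X : A X -> X `<=` E.
Proof. by move=> [Y YI <-] p [i Yi Rip]; exists i => //; exact: YI. Qed.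

Lemma partition_boolean_algebra : boolean_set_algebra E A.
Proof.
split; first exact: algebra_sub.
- by split; [exists set0 => //; exact: bigcup_set0|exists I].
- move=> _ _ [X XI <-] [Y YI <-]; exists (X `|` Y); last exact: bigcup_setU.
  by rewrite /= subUset.
- move=> X Y AX AY.
  have -> : X `&` Y = E `&` \bigcap_(b in [set X; Y]) b.
    rewrite bigcap_setU !bigcap_set1 [RHS]setIidr// => p [Xp _].
    exact: algebra_sub AX _ Xp.
  by apply: algebra_bigcap => _ [->|->].
- move=> _ [X XI <-]; exists (I `\` X); first by move=> i [].
  by rewrite block_bigcupD.
Qed.

Lemma partition_complete_algebra : complete_algebra A.
Proof.
move=> B BA; split.
  exists (\bigcup_(b in B) b); split; first exact: algebra_bigcup.
    by move=> X BX p Xp; exists X.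
  by move=> t _ Bt; exact: bigcup_sub.
exists (E `&` \bigcap_(b in B) b); split; first exact: algebra_bigcap.
  by move=> X BX p [_]; exact.
move=> t At tB; rewrite subsetI; split; first exact: algebra_sub.
exact: sub_bigcap.
Qed.

(** Inclusion of unions of blocks reflects to indices, so a member of [A] below [R i] is indexed by
    a subset of a singleton. *)
Lemma block_atom i : I i -> is_atom A (R i).
Proof.
move=> Ii; have SRi : S [set i] = R i by exact: bigcup_set1.
have iI : [set i] `<=` I by move=> _ ->.
split; first by exists [set i].
  by have [p Rip] := R_neq0 Ii => Ri0; rewrite Ri0 in Rip.
move=> _ [X XI <-]; rewrite -SRi => /(block_bigcup_le XI iI) /subset_set1.
by case=> ->; [left; exact: bigcup_set0|right].
Qed.

Lemma partition_atomic_algebra : atomic_algebra A.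
Proof.
move=> _ [X XI <-] /eqP/set0P[p [i Xi Rip]].
by exists (R i); [exact: block_atom (XI _ Xi)|move=> q Riq; exists i].
Qed.

(** An atom is nonempty, hence contains some block, and minimality makes it equal to that block. *)
Lemma partition_atoms : [set a | is_atom A a] = [set R i | i in I].
Proof.
apply/seteqP; split=> [a [Aa a0 amin]|_ [i Ii <-]]; last exact: block_atom.
have [X XI Sa] := Aa; have /eqP/set0P[p] := a0; rewrite -Sa => -[i Xi Rip].
exists i; first exact: XI.
have [Ai Ri0 _] := block_atom (XI _ Xi).
by rewrite Sa; case: (amin _ Ai) => // q Riq; rewrite -Sa; exists i.
Qed.

End PartitionAlgebra.

(** * The relations of a group pair as a partition of the unit *)

Section GroupPair.
Local Open Scope group_scope.
Variables (F : group_pair) (C : coset_enum F).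

Lemma mem_inU (x : gp_index F) (X : set (gp_group x)) g :
  inU X (existT _ x g) <-> X g.
Proof.
split=> [[h Xh]|Xg]; last by exists g.
(* Injectivity of the second component needs decidable equality of tags, provided classically by
   [{classic gp_index F}]. *)
by move=> /(@existT_inj2 {classic gp_index F} (fun z => gp_group z) x h g) <-.
Qed.

Lemma cosetK_bij x y : gp_equiv x y ->
  set_bij [set: ce_kappa C x y] (cosets (gp_K x y)) (@cosetK F C x y).
Proof.
move=> xy; have [phi_bij _] := gp_phi_iso F x y xy.
exact: set_bij_comp (ce_cosetP C xy) phi_bij.
Qed.

(** Existence will show that the relations cover the unit, uniqueness that they are disjoint. *)
Lemma relR_index_uniq x y (g : gp_group x) (h : gp_group y) : gp_equiv x y ->
  exists! a : ce_kappa C x y, relR a (existT _ x g, existT _ y h).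
Proof.
move=> xy; have nK := gp_K_normal F x y xy; have KP := cosetK_bij xy.
have Kc c : cosets (gp_K x y) (@cosetK F C x y c) by have [+ _ _] := KP; exact.
have [c [cg c_uniq]] :=
  coset_index_uniq (gp_H_normal F x y xy) g (ce_cosetP C xy).
have [k kc] := coset_nonempty nK (Kc c).
have relRE (a : ce_kappa C x y) :
    relR a (existT _ x g, existT _ y h) <-> cosetK a (k^-1 * h).
  rewrite -(mem_cprod_coset nK _ (Kc c) (Kc a) kc); split.
    (* The coset of [g] forces [d] to be [c], so the union defining [relR] collapses to one term. *)
    by move=> [d _ [/mem_inU /c_uniq <- /mem_inU]].
  by move=> ?; exists c => //; split; apply/mem_inU.
have [a [ak a_uniq]] := coset_index_uniq nK (k^-1 * h) KP.
by exists a; split=> [|b /relRE/a_uniq //]; apply/relRE.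
Qed.

Lemma relR_fst_snd x y (a : ce_kappa C x y) p :
  relR a p -> x = projT1 p.1 /\ y = projT1 p.2.
Proof. by move=> [c _ [[g _ <-] [h _ <-]]]. Qed.

Lemma relR_trivIset :
  trivIset (index_set C) (fun i : index_type C => relR (projT2 i)).
Proof.
move=> [[x y] a] [[x' y'] b] /= xy _ [[[x0 g] [y0 h]] /= [Ra Rb]].
have [/= ex ey] := relR_fst_snd Ra; have [/= ex' ey'] := relR_fst_snd Rb.
(* The tags of the common point identify the two index pairs; only then do [a] and [b] have the same
   type. *)
subst x0 y0 x' y'; have [d [_ d_uniq]] := relR_index_uniq g h xy.
by rewrite -(d_uniq _ Ra) -(d_uniq _ Rb).
Qed.

Lemma relR_nonempty x y (a : ce_kappa C x y) : gp_equiv x y -> relR a !=set0.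
Proof.
move=> xy; have nK := gp_K_normal F x y xy.
have [cfun _ _] := ce_cosetP C xy; have [Kfun _ _] := cosetK_bij xy.
have [g ag] := coset_nonempty (gp_H_normal F x y xy) (cfun a Logic.I).
have [k ak] := coset_nonempty nK (Kfun a Logic.I).
(* The point is taken in the term $\gamma=\alpha$ of the union,
   $H_{xy,\alpha}\times(K_{xy,\alpha}\circ K_{xy,\alpha})$. *)
exists (existT _ x g, existT _ y (k * k)), a => //.
by split; apply/mem_inU => //; exists k => //; exists k.
Qed.

Lemma unit_relE : unit_rel F = relS C (index_set C).
Proof.
apply/seteqP; split.
  move=> [_ _] [[x y] /= xy [/= [g _ <-] [h _ <-]]].
  have [a [Ra _]] := relR_index_uniq g h xy.
  by exists (existT _ (x, y) a).
move=> p [[[x y] a] /= xy [c _ [/= [g _ gE] [h _ hE]]]].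
by exists (x, y) => //; split; [exists g|exists h].
Qed.

End GroupPair.

(* Intersections of systems are taken relative to the unit, so that the empty
   system is covered; for a nonempty system of subsets this changes nothing. *)
Theorem theorem3p3 (F : group_pair) (C : coset_enum F) :
  [/\ boolean_set_algebra (unit_rel F) (algA C),
      complete_algebra (algA C) &
      atomic_algebra (algA C)] /\
  set_bij [set X | X `<=` index_set C] (algA C) (relS C) /\
  [set a | is_atom (algA C) a] =
    [set relR (projT2 i) | i in index_set C] /\
  unit_rel F = relS C (index_set C) /\
  (forall (Lambda : Type) (X : Lambda -> set (index_type C)),
    (forall xi, X xi `<=` index_set C) ->
    \bigcup_xi relS C (X xi) = relS C (\bigcup_xi X xi) /\
    unit_rel F `&` \bigcap_xi relS C (X xi) =
      relS C (index_set C `&` \bigcap_xi X xi)) /\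
  (forall X : set (index_type C), X `<=` index_set C ->
    relS C (index_set C) `\` relS C X = relS C (index_set C `\` X)).
Proof.
have disj := @relR_trivIset F C.
have neq0 i : index_set C i -> relR (projT2 i) !=set0.
  by move=> ?; exact: relR_nonempty.
(* Once the unit is a union of blocks, the goals have the shape of the partition lemmas. *)
rewrite (unit_relE C); split; last split; last split; last split=> //; last split.
- split; first exact: partition_boolean_algebra disj.
    exact: partition_complete_algebra disj.
  exact: partition_atomic_algebra disj neq0.
- exact: block_bigcup_bij disj neq0.
- exact: partition_atoms disj neq0.
- move=> L X XI; split; first by rewrite [RHS]bigcup_bigcup.
  exact: (block_bigcup_bigcap disj).
- exact: block_bigcupD disj.
Qed.
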